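(* Let $\mathbb{F}$ be a field, $\mathbf{Vec}$ the category of finite-dimensional $\mathbb{F}$-vector spaces, and $F:(\mathbb{R},\leq)\to\mathbf{Vec}$ a functor. If $F\cong\bigoplus_{k=1}^n\chi_{I_k}$ and $F\cong\bigoplus_{j=1}^m\chi_{I'_j}$ for intervals $I_1,\dots,I_n,I'_1,\dots,I'_m\subseteq\mathbb{R}$, then $n=m$ and the sequences $I_1,\dots,I_n$ and $I'_1,\dots,I'_m$ are the same up to reordering.
   Context: $(\mathbb{R},\leq)$ denotes the poset of real numbers viewed as a category. For an interval $I\subseteq\mathbb{R}$, the diagram $\chi_I:(\mathbb{R},\leq)\to\mathbf{Vec}$ is given by $\chi_I(a)=\mathbb{F}$ if $a\in I$ and $0$ otherwise, and $\chi_I(a\leq b)=\mathrm{Id}_{\mathbb{F}}$ if $a,b\in I$ and $0$ otherwise; in particular $\chi_{\mathbb{R}}$ and $\chi_{\emptyset}$ are the constant functors $\mathbb{F}$ and $0$ respectively. Direct sums of diagrams are objectwise and $\cong$ denotes natural isomorphism.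
   Formalization: All the intervals are assumed nonempty; if the empty interval were allowed the claim would fail, since its diagram is 0 (take F = 0, n = 1 with the empty interval, and m = 0). *)

(* Defs.v *)
From HB Require Import structures.
From mathcomp Require Import all_boot all_order all_algebra.
From mathcomp Require Import all_classical reals normedtype.

Set Implicit Arguments.
Unset Strict Implicit.
Unset Printing Implicit Defensive.

Import Order.TTheory GRing.Theory Num.Theory.
Local Open Scope ring_scope.
Local Open Scope classical_set_scope.

(* A functor from the poset P, seen as a category, to the finite-dimensional
   K-vector spaces. Since a <= b is a boolean, its proofs are all equal, so
   dmap really has one arrow for each comparable pair. *)
Record diagram (K : fieldType) (d : Order.disp_t) (P : porderType d) :=
  Diagram {
    dobj :> P -> vectType K;
    dmap : forall a b : P, (a <= b)%O -> 'Hom(dobj a, dobj b);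
    dmap_id : forall a : P, dmap (lexx a) = \1%VF;
    dmap_comp : forall (a b c : P) (ab : (a <= b)%O) (bc : (b <= c)%O),
      dmap (le_trans ab bc) = (dmap bc \o dmap ab)%VF
  }.

Section Diagrams.
Variables (K : fieldType) (d : Order.disp_t) (P : porderType d).
Implicit Types F G : diagram K P.

Definition natural F G (eta : forall a : P, 'Hom(F a, G a)) : Prop :=
  forall (a b : P) (ab : (a <= b)%O),
    (eta b \o dmap F ab)%VF = (dmap G ab \o eta a)%VF.

Definition nat_iso F G : Prop :=
  exists (eta : forall a : P, 'Hom(F a, G a))
         (theta : forall a : P, 'Hom(G a, F a)),
    [/\ natural eta, natural theta,
        (forall a, (theta a \o eta a)%VF = \1%VF)
      & (forall a, (eta a \o theta a)%VF = \1%VF)].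

Definition zero_space : vectType K := 'rV[K]_0.

Program Definition zero_diagram : diagram K P :=
  @Diagram K d P (fun=> zero_space) (fun _ _ _ => \1%VF) _ _.
Next Obligation. by []. Qed.
Next Obligation. by move=> a b c ab bc; rewrite comp_lfun1l. Qed.

Definition prod_lfun (U U' V V' : vectType K) (f : 'Hom(U, V))
    (g : 'Hom(U', V')) : 'Hom((U * U')%type, (V * V')%type) :=
  linfun (fun x : U * U' => (f x.1, g x.2) : V * V').

Lemma prod_lfunE (U U' V V' : vectType K) (f : 'Hom(U, V))
    (g : 'Hom(U', V')) (x : U * U') : prod_lfun f g x = (f x.1, g x.2).
Proof.
pose h := fun x : U * U' => (f x.1, g x.2) : V * V'.
have hl : linear h by move=> a u v; rewrite /h /= !linearP.
pose hL := GRing.isLinear.Build _ _ _ _ h hl.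
pose hh : {linear _ -> _} := HB.pack h hL.
exact: (lfunE hh x).
Qed.

Program Definition dsum F G : diagram K P :=
  @Diagram K d P (fun a => (F a * G a)%type : vectType K)
    (fun a b ab => prod_lfun (dmap F ab) (dmap G ab)) _ _.
Next Obligation.
by move=> F G a; apply/lfunP => -[x y]; rewrite prod_lfunE !dmap_id !id_lfunE.
Qed.
Next Obligation.
move=> F G a b c ab bc; apply/lfunP => -[x y].
by rewrite comp_lfunE !prod_lfunE /= !dmap_comp !comp_lfunE.
Qed.

End Diagrams.

Notation "\bigoplus_ ( k < n ) F" := (\big[@dsum _ _ _/@zero_diagram _ _ _]_(k < n) F)
  (at level 41, F at level 41, k, n at level 50,
   format "'[' \bigoplus_ ( k  <  n ) '/  '  F ']'").

Section IntervalDiagram.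
Variables (K : fieldType) (R : realType).

Definition chi_space (b : bool) : vectType K :=
  if b then (K^o : vectType K) else zero_space K.

Definition chi_map (b c : bool) : 'Hom(chi_space b, chi_space c) :=
  match b, c with
  | true, true => \1%VF
  | _, _ => 0
  end.

Lemma chi_map_id (b : bool) : chi_map b b = \1%VF.
Proof.
case: b => //=; apply/lfunP => x.
by rewrite [LHS](thinmx0 (_ : 'rV[K]_0)) [RHS](thinmx0 (_ : 'rV[K]_0)).
Qed.

Lemma chi_map_comp (b1 b2 b3 : bool) : (b1 -> b3 -> b2) ->
  chi_map b1 b3 = (chi_map b2 b3 \o chi_map b1 b2)%VF.
Proof.
case: b1 b2 b3 => [] [] [] //= h;
  by rewrite ?comp_lfun1l ?comp_lfun0l ?comp_lfun0r //; have := h isT isT.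
Qed.

(* is_interval holds of set0, whose diagram chi is zero: uniqueness of interval
   decompositions therefore has to assume that the intervals are nonempty. *)
Program Definition chi (I : set R) (itvI : is_interval I) : diagram K R :=
  @Diagram K _ R (fun a => chi_space (a \in I))
    (fun a b _ => chi_map (a \in I) (b \in I)) _ _.
Next Obligation. by move=> I itvI a; exact: chi_map_id. Qed.
Next Obligation.
move=> I itvI a b c ab bc; apply: chi_map_comp; rewrite !inE => Ia Ic.
by apply: (itvI a c) => //; rewrite ab bc.
Qed.

End IntervalDiagram.

Arguments chi K {R I} itvI.

(* Main.v *)
Require Import Defs.
From HB Require Import structures.
From mathcomp Require Import all_boot all_order all_algebra.
From mathcomp Require Import all_classical reals normedtype.
From mathcomp Require Import perm.

Local Open Scope classical_set_scope.

(** An isomorphism of diagrams preserves the rank of each structure map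
    [F a -> F b], and ranks add up over direct sums, so the rank of
    [F a -> F b] is the number of summands whose interval contains both [a]
    and [b]. Hence both decompositions have the same number of intervals
    containing [a] and [b], for all [a <= b].

    The same then holds with the pair [a, b] replaced by a nonempty set [J]: as
    only finitely many intervals are involved, [J] contains points [a <= b]
    spread so far apart that any of these intervals containing both contains
    all of [J] ([exists_endpoints]). Finally, a finite multiset in a partially
    ordered set is determined by the number of its elements above each point
    ([perm_eq_count_ge]); for intervals ordered by inclusion, this says that the
    two decompositions have the same intervals with the same multiplicities. *)

(** * Ranks of the structure maps *)

Section Rank.
Import Order.TTheory GRing.Theory.
Local Open Scope ring_scope.
Context {K : fieldType}.

Lemma dim_limg_le {U V : vectType K} (f : 'Hom(U, V)) (W : {vspace U}) :
  (\dim (f @: W) <= \dim W)%N.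
Proof. by rewrite -(limg_ker_dim f W) leq_addl. Qed.

Lemma dim_limg_comp_le {U V W X : vectType K}
    (f : 'Hom(U, V)) (g : 'Hom(V, W)) (h : 'Hom(W, X)) :
  (\dim (limg (h \o (g \o f))%VF) <= \dim (limg g))%N.
Proof.
rewrite !limg_comp; apply: leq_trans (dim_limg_le _ _) _.
by apply: dimvS; apply: limgS; exact: subvf.
Qed.

(** The image of [f (+) g] is the direct sum of the images of [f] and [g] under
    the coordinate injections [i1] and [i2]. *)
Lemma dim_limg_prod_lfun {U U' V V' : vectType K}
    (f : 'Hom(U, V)) (g : 'Hom(U', V')) :
  \dim (limg (prod_lfun f g)) = (\dim (limg f) + \dim (limg g))%N.
Proof.
have l1 : linear (fun x : V => (x, 0) : V * V').
  by move=> a u v; congr pair; rewrite /= scaler0 addr0.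
have l2 : linear (fun x : V' => (0, x) : V * V').
  by move=> a u v; congr pair; rewrite /= scaler0 addr0.
pose h1 : {linear _ -> _} := HB.pack (fun x : V => (x, 0) : V * V')
  (GRing.isLinear.Build _ _ _ _ _ l1).
pose h2 : {linear _ -> _} := HB.pack (fun x : V' => (0, x) : V * V')
  (GRing.isLinear.Build _ _ _ _ _ l2).
pose i1 : 'Hom(V, (V * V')%type) := linfun h1.
pose i2 : 'Hom(V', (V * V')%type) := linfun h2.
have i1E x : i1 x = (x, 0) by exact: (lfunE h1 x).
have i2E x : i2 x = (0, x) by exact: (lfunE h2 x).
have ker1 : lker i1 == 0%VS by apply/lker0P => x y; rewrite !i1E => -[].
have ker2 : lker i2 == 0%VS by apply/lker0P => x y; rewrite !i2E => -[].
have -> : limg (prod_lfun f g) = (i1 @: limg f + i2 @: limg g)%VS.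
  apply/eqP; rewrite eqEsubv; apply/andP; split; apply/subvP => z.
    case/memv_imgP => -[x y] _ ->; rewrite prod_lfunE/=.
    have -> : (f x, g y) = i1 (f x) + i2 (g y).
      by rewrite i1E i2E; congr pair; rewrite /= ?addr0 ?add0r.
    by rewrite memv_add// !memv_img ?memvf.
  case/memv_addP => _ /memv_imgP[_ /memv_imgP[x _ ->] ->].
  case=> _ /memv_imgP[_ /memv_imgP[y _ ->] ->] ->.
  have -> : i1 (f x) + i2 (g y) = prod_lfun f g (x, y).
    by rewrite prod_lfunE i1E i2E; congr pair; rewrite /= ?addr0 ?add0r.
  by rewrite memv_img ?memvf.
rewrite dimv_disjoint_sum.
  rewrite (limg_dim_eq (f := i1)) ?(eqP ker1) ?capv0//.
  by rewrite (limg_dim_eq (f := i2)) ?(eqP ker2) ?capv0.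
apply/eqP; rewrite -subv0; apply/subvP => z; rewrite memv_cap memv0 => /andP[].
by move=> /memv_imgP[x _ ->] /memv_imgP[y _]; rewrite i1E i2E => -[-> _].
Qed.

Section Diagram.
Context {d : Order.disp_t} {P : porderType d}.
Implicit Types F G : diagram K P.

Lemma nat_iso_sym F G : nat_iso F G -> nat_iso G F.
Proof. by case=> eta [theta [? ? ? ?]]; exists theta, eta; split. Qed.

(** By naturality [dmap F ab] factors through [dmap G ab]. *)
Lemma nat_iso_rank_le F G (a b : P) (ab : (a <= b)%O) : nat_iso F G ->
  (\dim (limg (dmap F ab)) <= \dim (limg (dmap G ab)))%N.
Proof.
case=> eta [theta [etaN _ etaK _]].
have -> : dmap F ab = (theta b \o (dmap G ab \o eta a))%VF.
  by rewrite -etaN comp_lfunA etaK comp_lfun1l.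
exact: dim_limg_comp_le.
Qed.

Lemma nat_iso_rank F G (a b : P) (ab : (a <= b)%O) : nat_iso F G ->
  \dim (limg (dmap F ab)) = \dim (limg (dmap G ab)).
Proof.
by move=> FG; apply/eqP; rewrite eqn_leq !nat_iso_rank_le//; exact: nat_iso_sym.
Qed.

End Diagram.

Lemma limg_zero {U V : vectType K} : limg (0 : 'Hom(U, V)) = 0%VS.
Proof.
by apply/eqP; rewrite -lkerE; apply/subvP => x _; rewrite memv_ker lfunE.
Qed.

Lemma rank_chi_map (b c : bool) : \dim (limg (chi_map K b c)) = (b && c).
Proof.
case: b c => [] [] /=; rewrite ?limg_zero ?dimv0//.
by rewrite lim1g dimvf.
Qed.

Lemma rank_bigoplus_chi {R : realType} {n : nat} (I : 'I_n -> set R)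
    (itvI : forall k, is_interval (I k)) (a b : R) (ab : (a <= b)%O) :
  \dim (limg (dmap (\bigoplus_(k < n) chi K (itvI k)) ab)) =
  (\sum_(k < n) ((a \in I k) && (b \in I k)))%N.
Proof.
pose rk (D : diagram K R) (r : nat) := \dim (limg (dmap D ab)) = r.
apply: (@big_ind2 _ _ rk).
- rewrite /rk; apply/eqP; rewrite -leqn0; apply: leq_trans (dim_limg_le _ _) _.
  by rewrite dimvf /dim.
- by move=> F r G s <- <-; exact: dim_limg_prod_lfun.
- by move=> k _; exact: rank_chi_map.
Qed.

End Rank.

(** * Counting the intervals above a point *)

Section Count.
Import Order.TTheory.
Local Open Scope order_scope.

(** The elements strictly above [x] form shorter sequences, which satisfy the
    hypothesis and hence agree by induction; subtracting their number from the
    number of elements above [x] leaves the multiplicity of [x]. *)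
Lemma perm_eq_count_ge {d : Order.disp_t} {T : porderType d} (s t : seq T) :
  {in s ++ t, forall x, count (>= x) s = count (>= x) t} -> perm_eq s t.
Proof.
have [n] := ubnP (size (s ++ t)).
elim: n s t => // n IH s t sz_st st; apply/allP => x xst /=.
pose gt_x (r : seq T) := [seq y <- r | x < y].
have count_gt_x r y : x < y -> count (>= y) (gt_x r) = count (>= y) r.
  move=> xy; rewrite count_filter; apply: eq_count => z /=.
  by case: (boolP (y <= z)) => //= yz; rewrite (lt_le_trans xy yz).
have split_ge r : count (>= x) r = (count_mem x r + size (gt_x r))%N.
  rewrite size_filter -count_predUI [X in (_ + X)%N](_ : _ = 0%N) ?addn0.
    by apply: eq_count => y /=; rewrite le_eqVlt eq_sym.
  apply/eqP; rewrite -leqn0 leqNgt -has_count; apply/hasPn => y _ /=.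
  by case: eqP => //= ->; rewrite ltxx.
have gt_perm : perm_eq (gt_x s) (gt_x t).
  apply: IH => [|y]; rewrite -filter_cat.
    rewrite ltnS in sz_st; apply: (leq_trans _ sz_st); rewrite size_filter.
    rewrite -(count_predC (> x) (s ++ t)) -[ltnLHS]addn0 ltn_add2l -has_count.
    by apply/hasP; exists x => //=; rewrite ltxx.
  by rewrite mem_filter => /andP[xy yst]; rewrite !count_gt_x// st.
have := st x xst; rewrite !split_ge (perm_size gt_perm) => /eqP.
by rewrite eqn_add2r.
Qed.

(** Choose a point of [J] outside each interval of [r] that does not contain
    [J]; the least and the greatest among these points and an arbitrary point
    of [J], needed in case there are none, serve as [a] and [b]. An interval containing both contains everything between them, in particular
    the point that was chosen outside it if there is one. *)
Lemma exists_endpoints {R : realType} (J : set R) (r : seq (set R)) :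
  J !=set0 -> {in r, forall I, is_interval I} ->
  exists a b : R, a <= b /\
    {in r, forall I : set R, (a \in I) && (b \in I) = (J <= I)}.
Proof.
move=> [x0 Jx0] itv_r.
suff [a [b [ab Ja Jb r_ab]]] : exists a b : R, [/\ a <= b, J a, J b &
    {in r, forall I : set R, I a -> I b -> J `<=` I}].
  exists a, b; split=> // I Ir; apply/andP/subsetPset; rewrite !inE.
    by case; exact: r_ab.
  by move=> JI; split; exact: JI.
elim: r itv_r => [|I r IH] itv_r; first by exists x0, x0.
have [|a [b [ab Ja Jb r_ab]]] := IH.
  by move=> I' I'r; apply: itv_r; rewrite inE I'r orbT.
have [JI|/existsNP[x /not_implyP[Jx nIx]]] := pselect (J `<=` I).
  by exists a, b; split=> // I'; rewrite inE => /predU1P[-> //|]; exact: r_ab.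
exists (Order.min a x), (Order.max b x); split.
- by rewrite ge_min le_max ab.
- by case: leP.
- by case: leP.
move=> I'; rewrite inE => I'Ir I'a I'b.
have I'P y : Order.min a x <= y <= Order.max b x -> I' y.
  by apply: (itv_r I') => //; rewrite inE.
case/predU1P: I'Ir => [I'I|I'r].
  by case: nIx; rewrite -I'I; apply: I'P; rewrite ge_min le_max lexx !orbT.
by apply: r_ab => //; apply: I'P; rewrite ge_min le_max ?lexx ?ab ?orbT.
Qed.

End Count.

(** * Uniqueness of interval decompositions *)

Theorem corollary4p7 (K : fieldType) (R : realType) (F : diagram K R)
  (n m : nat) (I : 'I_n -> set R) (I' : 'I_m -> set R)
  (itvI : forall k : 'I_n, is_interval (I k))
  (itvI' : forall j : 'I_m, is_interval (I' j))
  (I_neq0 : forall k : 'I_n, I k !=set0)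
  (I'_neq0 : forall j : 'I_m, I' j !=set0)
  (FI : nat_iso F (\bigoplus_(k < n) chi K (itvI k)))
  (FI' : nat_iso F (\bigoplus_(j < m) chi K (itvI' j))) :
  n = m /\
  exists s : 'I_n -> 'I_m, bijective s /\ forall k : 'I_n, I k = I' (s k).
Proof.
have II' : perm_eq (codom I) (codom I').
  have nz : {in codom I ++ codom I', forall J : set R, J !=set0}.
    by move=> J; rewrite mem_cat => /orP[] /codomP[k ->].
  have itv : {in codom I ++ codom I', forall J : set R, is_interval J}.
    by move=> J; rewrite mem_cat => /orP[] /codomP[k ->].
  apply: perm_eq_count_ge => J JII'.
  (* One pair [a, b] serves both families, so that both counts above [J] are
     the rank of the same map. *)
  have [a [b [ab abP]]] := exists_endpoints J _ (nz J JII') itv.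
  have countE p (L : 'I_p -> set R) (itvL : forall k, is_interval (L k)) :
      {subset codom L <= codom I ++ codom I'} ->
      nat_iso F (\bigoplus_(k < p) chi K (itvL k)) ->
      count (>= J)%O (codom L) = \dim (limg (dmap F ab)).
    move=> sub FL; rewrite (nat_iso_rank _ _ _ _ ab FL) rank_bigoplus_chi.
    rewrite count_map -sum1_count big_enum_cond big_mkcond /=.
    by apply: eq_bigr => k _; rewrite abP ?sub ?codom_f//=.
  rewrite (countE _ I itvI)//; last by move=> L LI; rewrite mem_cat LI.
  by rewrite (countE _ I' itvI')// => L LI'; rewrite mem_cat LI' orbT.
have nm : n = m by have := perm_size II'; rewrite !size_codom !card_ord.
split=> //; subst m.
have [p Ip] := tuple_permP (t := [tuple I' j | j < n]) II'.
exists p; split=> [|k]; first by exists (p^-1)%g; [exact: permK|exact: permKV].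
have := congr1 (fun r => nth set0 r k) Ip.
rewrite -tnth_nth tnth_mktuple tnth_mktuple => <-.
by rewrite (nth_map k) ?size_enum_ord// nth_ord_enum.
Qed.
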